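(* Let $n$ be a positive integer and let $Q_{4n}=\langle x,y\mid x^{2n}=y^4=1,\ x^n=y^2,\ x^y=x^{-1}\rangle$ be the generalized quaternion group of order $4n$. Then $Q_{4n}$ is power-chordal if and only if its subgroup $\langle x\rangle$ is power-chordal, i.e., if and only if $2n=2^ap^b$ for some odd prime $p$ and some $a,b\in\mathbb{N}_0$ with $a\leq 1$ or $b\leq 1$.
   Context: The power graph of a group $G$ is the simple graph with vertex set $G$ in which two distinct elements $x,y$ are joined by an edge if and only if $x^m=y$ or $y^m=x$ for some $m\in\mathbb{N}$. A graph is chordal if it has no induced cycle on at least four vertices. A group is power-chordal if its power graph is chordal. $\mathbb{N}_0$ denotes the non-negative integers. *)

(* Defs.v *)
From mathcomp Require Import all_boot all_fingroup all_solvable.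

Set Implicit Arguments.
Unset Strict Implicit.
Unset Printing Implicit Defensive.

Local Open Scope group_scope.

(* A simple graph is given by a vertex set V : {set T} and an adjacency
   relation E : T -> T -> Prop, symmetric and irreflexive, of which only the
   restriction to V matters. *)

(* c enumerates, in cyclic order and without repetition, k vertices of the
   graph whose induced subgraph is a cycle; ordS is the successor modulo k.
   This is the intended notion for k >= 3. *)
Definition induced_cycle (T : finType) (V : {set T}) (E : T -> T -> Prop)
    (k : nat) (c : 'I_k -> T) : Prop :=
  [/\ forall i, c i \in V,
      injective c &
      forall i j, E (c i) (c j) <-> j = ordS i \/ i = ordS j].

Definition chordal (T : finType) (V : {set T}) (E : T -> T -> Prop) : Prop :=
  forall (k : nat) (c : 'I_k -> T), 4 <= k -> ~ induced_cycle V E c.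

(* Exponents are positive; since the groups are finite, allowing m = 0 would
   give the same relation. *)
Definition power_adj (gT : finGroupType) (x y : gT) : Prop :=
  x <> y /\ exists2 m : nat, 0 < m & x ^+ m = y \/ y ^+ m = x.

Definition power_chordal (gT : finGroupType) (G : {group gT}) : Prop :=
  chordal G (@power_adj gT).

(* G is the group presented by
     < x, y | x^(2n) = y^4 = 1, x^n = y^2, x^y = x^-1 >
   with x and y : gT as the presenting generators.  The bound names of a Grp
   presentation are not visible outside it, so the last two fields make x and
   y a pair of generators of G satisfying the relations.  As G is finite, the
   surjective endomorphism sending the presenting generators to any such pair
   is an automorphism, so the choice of the pair is immaterial. *)
Definition quaternion_presentation (n : nat) (gT : finGroupType)
    (G : {group gT}) (x y : gT) : Prop :=
  [/\ G \isog Grp (u : v : u ^+ (2 * n)%N = 1, v ^+ 4 = 1, u ^+ n = v ^+ 2,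
                           u ^ v = u^-1),
      <<[set x; y]>> = G :> {set gT} &
      [/\ x ^+ (2 * n)%N = 1, y ^+ 4 = 1, x ^+ n = y ^+ 2 & x ^ y = x^-1]].

(* Main.v *)
Require Import Defs.
From mathcomp Require Import all_boot all_fingroup all_solvable.
From mathcomp Require Import ssralg zmodp.

Set Implicit Arguments.
Unset Strict Implicit.
Unset Printing Implicit Defensive.

(** In a cycle of length at least 4 the two neighbours of a vertex are distinct
    and not adjacent.  So a vertex whose neighbourhood is a clique, called
    simplicial, lies on no such induced cycle.

    Both chordality claims rest on this.  In the quaternion group, an element g
    outside <[x]> satisfies g ^+ 2 = y ^+ 2, which lies in <[x]>, and
    g ^+ 4 = 1.  If g = u ^+ m, then u is outside <[x]> too and m is odd, so
    that u = g ^+ m; hence all neighbours of g lie in <[g]>, a cyclic 2-group,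
    whose power graph is complete.  So g is simplicial, every long induced
    cycle of G lies in <[x]>, and G is power-chordal exactly when <[x]> is.

    In a cyclic group adjacency of distinct elements means that one order
    divides the other.  If the order of the group divides p ^ a * q, every nonempty set
    S of elements has a simplicial vertex: one of maximal order among those of
    S whose order is prime to q, or any vertex if there is none
    (power_chordal_cyclic).  Conversely the divisors p, p^2 q, q, p q^2 give an
    induced 4-cycle when p^2 q^2 divides the order, and p, pq, q, qr, r, pr an
    induced 6-cycle when three primes divide it.  For an even order, what
    remains is the arithmetic condition of the theorem
    (power_chordal_cyclic_even).

    Finally the order of x has to be exactly 2n, whereas the relations only
    show that it divides 2n.  A concrete group of permutations satisfying the
    relations, in which the first generator has order 2n and does not generate
    the second, is a quotient of G by the universal property of the
    presentation; so G has at least 4n elements, while the relations give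
    #|G| <= 2 * #[x] (quaternion_presentation_order). *)

(** * Chordality and simplicial vertices *)

Definition simplicial_in (T : finType) (E : T -> T -> Prop) (S : {set T})
    (v : T) : Prop :=
  forall u w, u \in S -> w \in S -> E v u -> E v w -> u <> w -> E u w.

Lemma iter_ordS_neq (k t : nat) (i : 'I_k) :
  0 < t < k -> iter t (@ordS k) i <> i.
Proof.
case/andP=> t_gt0 ltk /(congr1 val).
have ->: val (iter t (@ordS k) i) = (i + t) %% k.
  elim: t {t_gt0 ltk} => [|t IHt] /=; first by rewrite addn0 modn_small.
  by rewrite IHt -addn1 modnDml addn1 addnS.
move=> /= eq_i; have /eqP: i + t = i + 0 %[mod k].
  by rewrite addn0 [RHS]modn_small.
by rewrite eqn_modDl mod0n modn_small // gtn_eqF.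
Qed.

(** The neighbours ordS i and ord_pred i of i are 2 steps apart.  They could be
    equal or adjacent only if 2, 1 or 3 steps led back to the starting point,
    which needs k < 4. *)
Lemma induced_cycle_not_simplicial (T : finType) (V S : {set T})
    (E : T -> T -> Prop) (k : nat) (c : 'I_k -> T) (i : 'I_k) :
  4 <= k -> induced_cycle V E c -> (forall j, c j \in S) ->
  ~ simplicial_in E S (c i).
Proof.
move=> k_ge4 [_ c_inj adjE] Sc simp_i.
have neq t : 0 < t < 4 -> iter t (@ordS k) (ord_pred i) <> ord_pred i.
  by case/andP=> t0 t4; apply: iter_ordS_neq; rewrite t0 (leq_trans t4).
have [|adj|adj] := (adjE (ordS i) (ord_pred i)).1.
- apply: simp_i; rewrite ?Sc //.
  + by apply/adjE; left.
  + by apply/adjE; right; rewrite ord_predK.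
  by move/c_inj=> eq_i; apply: (neq 2) => //=; rewrite ord_predK.
- by apply: (neq 3) => //=; rewrite ord_predK.
- by apply: (neq 1) => //=; rewrite ord_predK; apply: (can_inj (@ordSK k)).
Qed.

(** The usual criterion by elimination orderings: it is applied to the vertex
    set of a putative induced cycle. *)
Lemma chordal_elimination (T : finType) (V : {set T}) (E : T -> T -> Prop) :
  (forall S : {set T}, S \subset V -> S != set0 ->
     exists2 v, v \in S & simplicial_in E S v) ->
  chordal V E.
Proof.
move=> elim_V k c k_ge4 cyc; have [Vc _ _] := cyc.
pose S := [set c i | i : 'I_k].
have Sc i : c i \in S by apply: imset_f.
have [||_ /imsetP[i _ ->]] := elim_V S.
- by apply/subsetP=> _ /imsetP[i _ ->].
- by apply/set0Pn; exists (c (Ordinal (leq_trans (isT : 0 < 4) k_ge4))).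
exact: induced_cycle_not_simplicial cyc Sc.
Qed.

Lemma chordal_subset (T : finType) (V W : {set T}) (E : T -> T -> Prop) :
  W \subset V -> chordal V E -> chordal W E.
Proof.
move=> /subsetP sWV chV k c k_ge4 [Wc c_inj adjE]; apply: (chV k c k_ge4).
by split=> // i; apply: sWV.
Qed.

Lemma chordal_del_simplicial (T : finType) (V W : {set T})
    (E : T -> T -> Prop) :
  (forall v, v \in V -> v \notin W -> simplicial_in E V v) ->
  chordal W E -> chordal V E.
Proof.
move=> simpV chW k c k_ge4 cyc; have [Vc c_inj adjE] := cyc.
apply: (chW k c k_ge4); split=> // i; apply/negPn/negP=> W'ci.
exact: (induced_cycle_not_simplicial k_ge4 cyc Vc (simpV _ (Vc i) W'ci)).
Qed.

(** * Power graphs of cyclic groups *)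

Section CyclicPowerGraph.

Local Open Scope group_scope.

Lemma power_adjP (gT : finGroupType) (u w : gT) :
  power_adj u w <-> u <> w /\ (w \in <[u]> \/ u \in <[w]>).
Proof.
split=> [[neq [m _ eq_m]]|[neq]].
  by split=> //; case: eq_m => <-; rewrite mem_cycle; [left | right].
have cyc (z t : gT) : t \in <[z]> -> exists2 m, (0 < m)%N & z ^+ m = t.
  case/cycleP=> m ->; exists (m + #[z])%N.
    by rewrite addn_gt0 order_gt0 orbT.
  by rewrite expgD expg_order mulg1.
by case=> /cyc[m m_gt0 eq_m]; split=> //; exists m => //; [left | right].
Qed.

Lemma mem_cycle_order (gT : finGroupType) (x u w : gT) :
  u \in <[x]> -> w \in <[x]> -> (w \in <[u]>) = (#[w] %| #[u])%N.
Proof.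
move=> xu xw; rewrite /order (cardSg_cyclic (cycle_cyclic x)) ?cycle_subG //.
Qed.

Lemma power_adj_cyclic (gT : finGroupType) (x u w : gT) :
  u \in <[x]> -> w \in <[x]> ->
  power_adj u w <-> u <> w /\ (#[w] %| #[u] \/ #[u] %| #[w])%N.
Proof.
by move=> xu xw; rewrite -!(mem_cycle_order (x := x)) //; apply: power_adjP.
Qed.

Lemma coprime_divisor_split (p q a d : nat) :
  prime q -> (d %| p ^ a * q)%N ->
  exists2 e, (e %| p ^ a)%N & d = e \/ d = (e * q)%N.
Proof.
move=> q_pr dv; have [q_dv|q_ndv] := boolP (q %| d)%N.
  have /dvdnP[e def_d] := q_dv; exists e; last by right.
  by move: dv; rewrite def_d dvdn_pmul2r ?prime_gt0.
exists d; last by left.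
by rewrite -(@Gauss_dvdl _ _ q) // coprime_sym prime_coprime.
Qed.

Lemma dvdn_pfactor_total (p a d e : nat) :
  prime p -> (d %| p ^ a -> e %| p ^ a -> d %| e \/ e %| d)%N.
Proof.
move=> p_pr /(dvdn_pfactor _ _ p_pr)[i _ ->] /(dvdn_pfactor _ _ p_pr)[j _ ->].
by case/orP: (leq_total i j) => le; [left | right]; apply: dvdn_exp2l.
Qed.

(** The divisors of p ^ a * q form two chains, the p ^ i and the p ^ i * q.  Let
    v be of maximal order p ^ i on the first chain.  Its neighbours on the first
    chain have orders dividing p ^ i, those on the second have orders divisible
    by p ^ i, so any two neighbours of v are comparable. *)
Lemma power_chordal_cyclic (gT : finGroupType) (x : gT) (p q a : nat) :
  prime p -> prime q -> (#[x] %| p ^ a * q)%N -> power_chordal <[x]>%G.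
Proof.
move=> p_pr q_pr dv_x; apply: chordal_elimination => S /subsetP sSx S_n0.
have dvS z : z \in S -> (#[z] %| p ^ a * q)%N.
  by move=> /sSx xz; apply: dvdn_trans dv_x; apply: order_dvdG.
have adj u w : u \in S -> w \in S -> u <> w ->
    (#[u] %| #[w] \/ #[w] %| #[u])%N -> power_adj u w.
  move=> Su Sw neq cmp; apply/(power_adj_cyclic (sSx u Su) (sSx w Sw)).
  by split=> //; case: cmp; [right | left].
have dv_p z : z \in S -> ~~ (q %| #[z])%N -> (#[z] %| p ^ a)%N.
  move=> Sz; have [e dv_e [->|->]] := coprime_divisor_split q_pr (dvS z Sz) => //.
  by rewrite dvdn_mull.
have cmp_p u w : u \in S -> w \in S -> ~~ (q %| #[u])%N -> ~~ (q %| #[w])%N ->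
    (#[u] %| #[w] \/ #[w] %| #[u])%N.
  by move=> Su Sw qu qw; apply: (dvdn_pfactor_total p_pr); apply: dv_p.
have cmp_q u w : u \in S -> w \in S -> (q %| #[u])%N -> (q %| #[w])%N ->
    (#[u] %| #[w] \/ #[w] %| #[u])%N.
  have split_q z : z \in S -> (q %| #[z])%N ->
      exists2 e, (e %| p ^ a)%N & #[z] = (e * q)%N.
    move=> Sz /dvdnP[e def_z]; exists e => //.
    by move: (dvS z Sz); rewrite def_z dvdn_pmul2r ?prime_gt0.
  move=> Su Sw /(split_q u Su)[d dv_d ->] /(split_q w Sw)[e dv_e ->].
  by rewrite !dvdn_pmul2r ?prime_gt0 //; apply: (dvdn_pfactor_total p_pr dv_d dv_e).
case: (pickP [pred z in S | ~~ (q %| #[z])%N]) => [z0 Pz0 | all_q]; last first.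
  have [v Sv] := set0Pn _ S_n0; exists v => // u w Su Sw _ _ neq.
  have q_dv z : z \in S -> (q %| #[z])%N.
    by move=> Sz; move: (all_q z); rewrite /= Sz => /negbFE.
  by apply: adj => //; apply: cmp_q; rewrite ?q_dv.
have [v /andP[/= Sv qv] max_v] := @arg_maxnP _ z0 _ (fun z : gT => #[z]) Pz0.
exists v => // u w Su Sw vu vw neq; apply: adj => //.
have cmp_v z : z \in S -> power_adj v z -> 
    if (q %| #[z])%N then (#[v] %| #[z])%N else (#[z] %| #[v])%N.
  move=> Sz /(power_adj_cyclic (sSx v Sv) (sSx z Sz))[_ cmp_z].
  case: ifPn => qz.
    by case: cmp_z => // /(dvdn_trans qz) /idPn[].
  case: (cmp_p v z Sv Sz qv qz) => // dv_vz.
  have := max_v z; rewrite /= Sz qz => /(_ isT) le_zv.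
  have /eqP -> // : #[z] == #[v].
  by rewrite eqn_leq le_zv dvdn_leq // order_gt0.
move: (cmp_v u Su vu) (cmp_v w Sw vw).
case: ifPn => qu; case: ifPn => qw dv_u dv_w.
- exact: cmp_q.
- by right; apply: dvdn_trans dv_u.
- by left; apply: dvdn_trans dv_w.
- exact: cmp_p.
Qed.

End CyclicPowerGraph.

(** * Obstructions: cycles of divisors *)

(** Divisors are encoded by their exponents over a fixed list of primes: the
    incidences of a cycle of divisors then become a finite computation on
    lists of exponents. *)
Fixpoint monomial (s e : seq nat) : nat :=
  match s, e with
  | p :: s', i :: e' => p ^ i * monomial s' e'
  | _, _ => 1
  end.

Lemma coprime_monomial (p : nat) (s e : seq nat) :
  prime p -> all prime s -> p \notin s -> coprime p (monomial s e).
Proof.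
move=> p_pr; elim: s e => [|q s IHs] [|i e] //=; rewrite ?coprimen1 //.
case/andP=> q_pr s_pr; rewrite inE negb_or => /andP[neq_pq s'p].
rewrite coprimeMr IHs // andbT coprimeXr //.
by rewrite prime_coprime // dvdn_prime2.
Qed.

Lemma dvdn_monomial (s e f : seq nat) :
  all prime s -> uniq s -> size e = size s -> size f = size s ->
  (monomial s e %| monomial s f) = all2 leq e f.
Proof.
elim: s e f => [|p s IHs] [|i e] [|j f] //= /andP[p_pr s_pr] /andP[s'p uniq_s].
move=> [sz_e] [sz_f]; have co t m : coprime (p ^ m) (monomial s t).
  by rewrite coprimeXl // coprime_monomial.
rewrite Gauss_dvd // Gauss_dvdl // Gauss_dvdr 1?coprime_sym //.
by rewrite dvdn_Pexp2l ?prime_gt1 // IHs.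
Qed.

Section Obstructions.

Local Open Scope group_scope.

(** Elements of <[x]> of the prescribed orders d i, taken among the powers of x,
    realise a cycle of divisors of #[x] as an induced cycle. *)
Lemma not_power_chordal_divisor_cycle (gT : finGroupType) (x : gT) (k : nat)
    (d : 'I_k -> nat) :
  (4 <= k)%N -> (forall i, d i %| #[x])%N ->
  (forall i j, [&& i != j & (d i %| d j) || (d j %| d i)]%N
               = (j == ordS i) || (i == ordS j)) ->
  injective d -> ~ power_chordal <[x]>%G.
Proof.
move=> k_ge4 dvd_d cyc d_inj chord.
pose c i := x ^+ (#[x] %/ d i).
have oc i : #[c i] = d i.
  rewrite orderXdiv ?dvdn_div ?dvd_d //.
  by rewrite divnA ?mulKn ?order_gt0 ?dvd_d //.
have c_inj : injective c by move=> i j eq_c; apply: d_inj; rewrite -!oc eq_c.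
have xc i : c i \in <[x]> by apply: mem_cycle.
apply: (chord k c k_ge4); split=> // i j.
have [adj_ij ij_adj] := power_adj_cyclic (xc i) (xc j).
rewrite !oc in adj_ij ij_adj; split=> [/adj_ij[neq cmp] | adj].
  have := cyc i j; rewrite (introN eqP) => [|eq_ij]; last by rewrite eq_ij in neq.
  have -> : ((d i %| d j) || (d j %| d i))%N.
    by case: cmp => ->; rewrite ?orbT.
  by move/esym/orP => [/eqP|/eqP]; [left | right].
have := cyc i j; have -> : (j == ordS i) || (i == ordS j).
  by case: adj => /eqP ->; rewrite ?orbT.
case/andP=> /eqP neq /orP cmp; apply: ij_adj; split; first by move/c_inj.
by case: cmp; [right | left].
Qed.

Lemma not_power_chordal_monomial_cycle (gT : finGroupType) (x : gT)
    (s top : seq nat) (k : nat) (e : 'I_k -> seq nat) :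
  all prime s -> uniq s -> size top = size s -> (monomial s top %| #[x])%N ->
  (4 <= k)%N -> (forall i, size (e i) = size s) ->
  (forall i, all2 leq (e i) top) ->
  (forall i j, all2 leq (e i) (e j) || all2 leq (e j) (e i)
               = [|| i == j, j == ordS i | i == ordS j]) ->
  (forall i j, all2 leq (e i) (e j) && all2 leq (e j) (e i) = (i == j)) ->
  ~ power_chordal <[x]>%G.
Proof.
move=> s_pr s_uniq sz_top dv_top k_ge4 sz_e le_top cyc anti.
have dvd_e i j : (monomial s (e i) %| monomial s (e j))%N = all2 leq (e i) (e j).
  exact: dvdn_monomial.
apply: (not_power_chordal_divisor_cycle (d := fun i => monomial s (e i))) => //.
- by move=> i; apply: dvdn_trans dv_top; rewrite dvdn_monomial.
- move=> i j; rewrite !dvd_e cyc; case: eqP => //= ->; rewrite orbb.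
  apply/esym/eqP=> /esym; apply: (@iter_ordS_neq k 1).
  by rewrite (leq_trans _ k_ge4).
- move=> i j eq_m; apply/eqP; rewrite -anti -!dvd_e.
  by rewrite -eq_m !dvdnn.
Qed.

Lemma not_power_chordal_two_squares (gT : finGroupType) (x : gT) (p q : nat) :
  prime p -> prime q -> p != q -> (p ^ 2 * q ^ 2 %| #[x])%N ->
  ~ power_chordal <[x]>%G.
Proof.
move=> p_pr q_pr neq dv.
pose e (i : 'I_4) := nth [::] [:: [:: 1; 0]; [:: 2; 1]; [:: 0; 1]; [:: 1; 2]]%N i.
apply: (@not_power_chordal_monomial_cycle _ x [:: p; q] [:: 2; 2]%N 4 e) => //=.
- by rewrite p_pr q_pr.
- by rewrite inE neq.
- by rewrite muln1.
- by case=> [[|[|[|[|]]]]].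
- by case=> [[|[|[|[|]]]]].
- by case=> [[|[|[|[|]]]] // ?]; case=> [[|[|[|[|]]]] // ?].
- by case=> [[|[|[|[|]]]] // ?]; case=> [[|[|[|[|]]]] // ?].
Qed.

Lemma not_power_chordal_three_primes (gT : finGroupType) (x : gT)
    (p q r : nat) :
  prime p -> prime q -> prime r -> uniq [:: p; q; r] ->
  (p * q * r %| #[x])%N -> ~ power_chordal <[x]>%G.
Proof.
move=> p_pr q_pr r_pr uniq_s dv.
pose e (i : 'I_6) := nth [::] [:: [:: 1; 0; 0]; [:: 1; 1; 0]; [:: 0; 1; 0];
                                 [:: 0; 1; 1]; [:: 0; 0; 1]; [:: 1; 0; 1]]%N i.
apply: (@not_power_chordal_monomial_cycle _ x [:: p; q; r] [:: 1; 1; 1]%N 6 e) => //.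
- by rewrite /= p_pr q_pr r_pr.
- by rewrite /= !expn1 muln1 mulnA.
- by case=> [[|[|[|[|[|[|]]]]]]].
- by case=> [[|[|[|[|[|[|]]]]]]].
- by case=> [[|[|[|[|[|[|]]]]]] // ?]; case=> [[|[|[|[|[|[|]]]]]] // ?].
- by case=> [[|[|[|[|[|[|]]]]]] // ?]; case=> [[|[|[|[|[|[|]]]]]] // ?].
Qed.

(** As 2 divides the order, the absence of three prime divisors leaves at most
    one odd prime p, and the absence of a divisor 2^2 p^2 bounds one of the two
    exponents by 1. *)
Lemma power_chordal_cyclic_even (gT : finGroupType) (x : gT) :
  ~~ odd #[x] ->
  power_chordal <[x]>%G <->
  exists p a b : nat,
    [/\ prime p, odd p, #[x] = (2 ^ a * p ^ b)%N & a <= 1 \/ b <= 1]%N.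
Proof.
move=> even_x; split=> [chord | [p [a [b [p_pr p_odd def_x le_ab]]]]]; last first.
  case: le_ab => le1.
    apply: (@power_chordal_cyclic _ _ p 2 b) => //.
    by rewrite def_x mulnC dvdn_mul // (@dvdn_exp2l 2 a 1).
  apply: (@power_chordal_cyclic _ _ 2 p a) => //.
  by rewrite def_x dvdn_mul // (@dvdn_exp2l p b 1).
have dv2 : (2 %| #[x])%N by rewrite dvdn2.
have [m co_m def_x] := pfactor_coprime (isT : prime 2) (order_gt0 x).
set a := logn 2 #[x] in def_x.
have a_gt0 : (0 < a)%N by rewrite logn_gt0 mem_primes /= order_gt0.
have m_gt0 : (0 < m)%N.
  by have := order_gt0 x; rewrite def_x muln_gt0 => /andP[].
have [m1|m_neq1] := eqVneq m 1%N.
  (* For a power of 2 any odd prime will do, with exponent 0. *)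
  exists 3%N, a, 0%N; split=> //; last by right.
  by rewrite {1}def_x m1 mul1n expn0 muln1.
have m_gt1 : (1 < m)%N by rewrite ltn_neqAle eq_sym m_neq1.
set p := pdiv m; have p_pr : prime p by apply: pdiv_prime.
have odd_m : odd m by rewrite -coprime2n.
have p_odd : odd p by apply: dvdn_odd odd_m; apply: pdiv_dvd.
have neq2 q : odd q -> 2%N != q by case: eqP => // <-.
have [m' co_m' def_m] := pfactor_coprime p_pr m_gt0.
set b := logn p m in def_m.
have b_gt0 : (0 < b)%N by rewrite logn_gt0 mem_primes p_pr m_gt0 pdiv_dvd.
have [m'1|m'_neq1] := eqVneq m' 1%N; last first.
  have m'_gt1 : (1 < m')%N.
    rewrite ltn_neqAle eq_sym m'_neq1.
    by move: m_gt0; rewrite def_m muln_gt0 => /andP[].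
  set r := pdiv m'; have r_pr : prime r by apply: pdiv_prime.
  have dv_r : (r %| m')%N by apply: pdiv_dvd.
  have r_odd : odd r.
    by apply: dvdn_odd odd_m; rewrite def_m dvdn_mulr.
  have neq_pr : p != r.
    by apply: contraTneq dv_r => <-; rewrite -prime_coprime.
  case: (@not_power_chordal_three_primes _ x r p 2 r_pr p_pr isT) => //.
    by rewrite /= !inE !negb_or !(eq_sym _ 2%N) !neq2 // eq_sym neq_pr.
  rewrite def_x def_m !dvdn_mul //; [exact: dvdn_exp | exact: dvdn_exp].
exists p, a, b; split=> //; first by rewrite def_x def_m m'1 mul1n mulnC.
have [a_le1|a_gt1] := leqP a 1; [by left | right].
rewrite leqNgt; apply/negP=> b_gt1.
apply: (@not_power_chordal_two_squares _ x p 2 p_pr isT) chord.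
  by rewrite eq_sym neq2.
by rewrite def_x def_m m'1 mul1n dvdn_mul // dvdn_exp2l.
Qed.

End Obstructions.

(** * Dicyclic groups *)

Section Dicyclic.

Local Open Scope group_scope.

Section Relations.

Variables (gT : finGroupType) (x y : gT) (n : nat).
Hypotheses (y4 : y ^+ 4 = 1) (xn : x ^+ n = y ^+ 2) (xy : x ^ y = x^-1).

Lemma dicyclic_norm : y \in 'N(<[x]>).
Proof. by rewrite -cycle_subG cycle_subG inE -cycleJ xy cycleV. Qed.

Lemma dicyclic_sub_cosets : <<[set x; y]>> \subset <[x]> :|: <[x]> :* y.
Proof.
have -> : <<[set x; y]>> = <[x]> <*> <[y]>.
  by rewrite joing_idl joing_idr.
rewrite norm_joinEr ?cycle_subG ?dicyclic_norm //.
apply/subsetP=> _ /mulsgP[z _ xz /cycleP[k ->] ->].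
have x_y2 m : y ^+ (m.*2) \in <[x]>.
  by rewrite -mul2n expgM -xn -expgM mem_cycle.
rewrite inE -(odd_double_half k) addnC expgD mulgA.
case: (odd k); rewrite ?expg1 ?expg0 ?mulg1.
  by rewrite orbC mem_rcoset mulgK groupM.
by rewrite groupM.
Qed.

Lemma dicyclic_card : (#|<<[set x; y]>>| <= 2 * #[x])%N.
Proof.
apply: leq_trans (subset_leq_card dicyclic_sub_cosets) _.
apply: leq_trans (leq_card_setU _ _) _.
by rewrite card_rcoset mul2n -addnn.
Qed.

(** For g = x ^+ i * y one has g ^+ 2 = x ^+ i * (x ^+ i) ^ y^-1 * y ^+ 2, and y
    inverts x. *)
Lemma dicyclic_outer_square (g : gT) :
  g \in <<[set x; y]>> -> g \notin <[x]> -> g ^+ 2 = y ^+ 2.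
Proof.
move/(subsetP dicyclic_sub_cosets); rewrite inE => /orP[-> // | ].
case/rcosetP=> _ /cycleP[i ->] -> _.
rewrite !expgS !expg0 !mulg1 mulgA -(mulgA _ y) (conjgCV y) conjXg.
have -> : x ^ y^-1 = x^-1.
  by apply: (conjg_inj y); rewrite conjgKV conjVg xy invgK.
by rewrite expgVn mulgA mulgV mul1g.
Qed.

(** All neighbours of g lie in the cyclic 2-group <[g]>, where any two elements
    are comparable.  The point is that an element u with g = u ^+ m is itself a
    power of g. *)
Lemma dicyclic_outer_simplicial (g : gT) :
  g \in <<[set x; y]>> -> g \notin <[x]> ->
  simplicial_in (@power_adj gT) <<[set x; y]>> g.
Proof.
move=> Gg x'g.
have outer4 z : z \in <<[set x; y]>> -> z \notin <[x]> -> z ^+ 4 = 1.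
  by move=> Gz x'z; rewrite (expgM z 2 2) (dicyclic_outer_square Gz) // -expgM.
have nbr_g u : u \in <<[set x; y]>> -> power_adj g u -> u \in <[g]>.
  move=> Gu /power_adjP[_ [// | /cycleP[m def_g]]].
  have x'u : u \notin <[x]> by apply: contra x'g => xu; rewrite def_g groupX.
  suff -> : u = g ^+ m by rewrite mem_cycle.
  (* An even power of u is a power of u ^+ 2 = x ^+ n. *)
  have odd_m : odd m.
    apply: contraR x'g => /negbTE even_m.
    rewrite def_g -(odd_double_half m) even_m add0n -mul2n expgM.
    by rewrite (dicyclic_outer_square Gu) // -xn -expgM mem_cycle.
  rewrite def_g -expgM -(expg_mod _ (outer4 u Gu x'u)).
  (* Odd squares are 1 modulo 4, so that g ^+ m = u ^+ (m * m) = u. *)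
  have -> : (m * m %% 4 = 1)%N.
    rewrite -(odd_double_half m) odd_m -modnMm -muln2; set h := m./2.
    rewrite (divn_eq h 2) mulnDl -mulnA addnCA modnMDl.
    by have := ltn_pmod h (isT : 0 < 2)%N; case: (h %% 2)%N => [|[]].
  by [].
have g_dv z : z \in <[g]> -> (#[z] %| 2 ^ 2)%N.
  by move=> gz; rewrite (dvdn_trans (order_dvdG gz)) // order_dvdn outer4.
move=> u w Gu Gw /(nbr_g u Gu) gu /(nbr_g w Gw) gw neq.
apply/(power_adj_cyclic gu gw); split=> //.
exact: (@dvdn_pfactor_total 2 2 _ _ isT (g_dv _ gw) (g_dv _ gu)).
Qed.

End Relations.

(** * A permutation model of the dicyclic group *)

Section Model.

Variable n : nat.
Hypothesis n_gt0 : (0 < n)%N.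

Let Z := 'Z_(2 * n).

Let m_gt1 : (1 < 2 * n)%N. Proof. by rewrite mul2n -addnn (leq_add n_gt0). Qed.

(** The pairs (i, false) and (i, true) stand for the elements x ^+ i and
    x ^+ i * y of the regular representation: the rotation and the flip are the
    right multiplications by x and by y, where x ^+ i * y * x = x ^+ (i - 1) * y
    and x ^+ i * y * y = x ^+ (i + n). *)
Definition dicyclic_rot_fun (t : Z * bool) : Z * bool :=
  ((if t.2 then t.1 - 1 else t.1 + 1)%R, t.2).

Definition dicyclic_flip_fun (t : Z * bool) : Z * bool :=
  if t.2 then ((t.1 + n%:R)%R, false) else (t.1, true).

Lemma dicyclic_rot_inj : injective dicyclic_rot_fun.
Proof.
move=> [i b] [j c] [] /= + eq_bc; rewrite eq_bc.
by case: c {eq_bc} => /GRing.addIr ->.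
Qed.

Lemma dicyclic_flip_inj : injective dicyclic_flip_fun.
Proof.
move=> [i b] [j c]; rewrite /dicyclic_flip_fun /=.
case: b c => [] [] //; first by move/(congr1 fst)/GRing.addIr=> /= ->.
by case=> ->.
Qed.

Definition dicyclic_rot : {perm Z * bool} := perm dicyclic_rot_inj.
Definition dicyclic_flip : {perm Z * bool} := perm dicyclic_flip_inj.

Lemma dicyclic_rotX k (i : Z) b :
  (dicyclic_rot ^+ k) (i, b) = ((if b then i - k%:R else i + k%:R)%R, b).
Proof.
elim: k i b => [|k IHk] i b.
  by rewrite expg0 perm1; case: b; rewrite ?GRing.subr0 ?GRing.addr0.
rewrite expgS permM permE /dicyclic_rot_fun /= IHk -GRing.nat1r; congr pair.
by case: b; rewrite ?GRing.opprD GRing.addrA.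
Qed.

Lemma Zp_half_opp : (- n%:R)%R = n%:R%R :> Z.
Proof.
apply: GRing.addr0_eq.
by rewrite -GRing.natrD addnn -mul2n pchar_Zp.
Qed.

Lemma dicyclic_rot_order : #[dicyclic_rot] = (2 * n)%N.
Proof.
apply/eqP; rewrite eqn_dvd; apply/andP; split.
  rewrite order_dvdn; apply/eqP/permP=> [[i b]]; rewrite dicyclic_rotX perm1.
  by rewrite pchar_Zp // GRing.subr0 GRing.addr0; case: b.
have := congr1 (fun s : {perm Z * bool} => s (0%R, false))
  (expg_order dicyclic_rot).
rewrite dicyclic_rotX perm1 GRing.add0r => /(congr1 (fun t => val t.1)) /=.
by rewrite val_Zp_nat // => /eqP.
Qed.

Lemma dicyclic_flip_outer : dicyclic_flip \notin <[dicyclic_rot]>.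
Proof.
apply/negP=> /cycleP[k] /(congr1 (fun s : {perm Z * bool} => s (0%R, false))).
by rewrite dicyclic_rotX permE.
Qed.

Lemma dicyclic_rot_flip : dicyclic_rot ^+ n = dicyclic_flip ^+ 2.
Proof.
apply/permP=> [[i b]]; rewrite dicyclic_rotX Zp_half_opp expgS expg1 permM !permE.
by case: b.
Qed.

Lemma dicyclic_flip_conj : dicyclic_rot ^ dicyclic_flip = dicyclic_rot^-1.
Proof.
have ufu : dicyclic_rot * dicyclic_flip * dicyclic_rot = dicyclic_flip.
  apply/permP=> [[i []]]; rewrite !permM !permE /dicyclic_rot_fun /=.
    by rewrite /dicyclic_flip_fun /= GRing.addrAC GRing.subrK.
  by rewrite /dicyclic_flip_fun /= GRing.addrK.
apply: (mulIg dicyclic_rot); rewrite mulVg conjgE.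
by rewrite -!mulgA (mulgA dicyclic_rot) ufu mulVg.
Qed.

Lemma dicyclic_flip4 : dicyclic_flip ^+ 4 = 1.
Proof.
rewrite (expgM _ 2 2) -dicyclic_rot_flip -expgM; apply/eqP.
by rewrite -order_dvdn dicyclic_rot_order mulnC.
Qed.

End Model.

(** Hiding the model makes its type opaque: 2 * n occurs in it, which would
    obstruct rewriting with 2 * n. *)
Lemma dicyclic_model (n : nat) : (0 < n)%N ->
  exists (rT : finGroupType) (u v : rT),
    [/\ #[u] = (2 * n)%N, v \notin <[u]> &
        [/\ v ^+ 4 = 1, u ^+ n = v ^+ 2 & u ^ v = u^-1]].
Proof.
move=> n_gt0; exists {perm 'Z_(2 * n) * bool}.
exists (dicyclic_rot n), (dicyclic_flip n); split; last split.
- exact: dicyclic_rot_order.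
- exact: dicyclic_flip_outer.
- exact: dicyclic_flip4.
- exact: dicyclic_rot_flip.
- exact: dicyclic_flip_conj.
Qed.

(** The model is a homomorphic image H of G, in which <[u]> of order 2n is a
    proper subgroup.  So #|G| is a multiple of 2n larger than 2n. *)
Lemma quaternion_presentation_order (n : nat) (gT : finGroupType)
    (G : {group gT}) (x y : gT) :
  (0 < n)%N -> quaternion_presentation n G x y -> #[x] = (2 * n)%N.
Proof.
move=> n_gt0 [isoG defG [x2n y4 xn xy]].
have [rT [u [v [ou u'v [v4 un uv]]]]] := dicyclic_model n_gt0.
have dv_x : (#[x] %| 2 * n)%N by rewrite order_dvdn x2n.
have homH : (<[u]> <*> <[v]>)%G \homg G.
  rewrite isoG; apply/existsP; exists (u, v) => /=.
  by rewrite !xpair_eqE /= -ou expg_order v4 un uv !eqxx.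
have ltG : (2 * n < #|G|)%N.
  apply: leq_trans (leq_homg homH); rewrite -ou; apply: proper_card.
  by rewrite properE joing_subl join_subG subxx cycle_subG.
have leG : (#|G| <= 2 * #[x])%N by rewrite -defG (dicyclic_card xn xy).
have dvG : (2 * n %| #|G|)%N.
  by rewrite -ou (dvdn_trans _ (card_homg homH)) // cardSg ?joing_subl.
have le4n : (2 * (2 * n) <= #|G|)%N.
  have /dvdnP[k def_k] := dvG; move: ltG; rewrite def_k.
  by rewrite -{1}(mul1n (2 * n)%N) ltn_pmul2r ?leq_pmul2r ?muln_gt0.
apply/eqP; rewrite eqn_leq dvdn_leq ?muln_gt0 //=.
by rewrite -(@leq_pmul2l 2) // (leq_trans le4n).
Qed.

End Dicyclic.

Theorem lemma3p16 (n : nat) (hn : 0 < n) (gT : finGroupType)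
    (G : {group gT}) (x y : gT) (hQ : quaternion_presentation n G x y) :
  (power_chordal G <-> power_chordal <[x]>%G) /\
  (power_chordal <[x]>%G <->
     exists p a b : nat,
       [/\ prime p, odd p, (2 * n = 2 ^ a * p ^ b)%N & a <= 1 \/ b <= 1]).
Proof.
have ox := quaternion_presentation_order hn hQ.
have [_ defG [_ y4 xn xy]] := hQ.
split; last first.
  by rewrite -ox; apply: power_chordal_cyclic_even; rewrite ox oddM.
split=> [|chord_x].
  by apply: chordal_subset; rewrite -defG cycle_subG mem_gen // !inE eqxx.
apply: chordal_del_simplicial chord_x; rewrite /= -defG.
exact: dicyclic_outer_simplicial y4 xn xy.
Qed.
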